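(* Let $F\colon S(n)\to\mathbb{R}$ be sublinear and uniformly elliptic with associated convex body $\mathcal{K}\subseteq S(n)$. Let $\Omega\subseteq\mathbb{R}^n$ be nonempty and open and let $u\colon\Omega\to(-\infty,\infty]$ be a function. Then $u$ is a viscosity supersolution of $F(\mathcal{H}w)=0$ in $\Omega$ if and only if, for every $Z\in\mathcal{K}$, the function $u_Z(x):=u(\sqrt{Z}\,x)$ is superharmonic in $\Omega_Z:=\{x\in\mathbb{R}^n\;|\;\sqrt{Z}\,x\in\Omega\}$.
   Context: Here $n\geq 2$ and $S(n)$ is the space of symmetric real $n\times n$ matrices with inner product $\langle X,Y\rangle=\operatorname{tr}(XY)$, partially ordered by $X\leq Y$ iff $\xi^TX\xi\leq\xi^TY\xi$ for all $\xi\in\mathbb{R}^n$; $\mathcal{H}w$ is the Hessian matrix of $w$. $F$ is sublinear if $F(X+Y)\leq F(X)+F(Y)$ and $F(tX)=tF(X)$ for all $X,Y\in S(n)$, $t\geq 0$. $F$ is uniformly elliptic if there are constants $0<\lambda\leq\Lambda$ such that $\lambda\operatorname{tr}A\leq F(X+A)-F(X)\leq\Lambda\operatorname{tr}A$ for all $X,A\in S(n)$ with $A\geq 0$. The associated convex body of a sublinear $F$ is the unique nonempty compact convex set $\mathcal{K}\subseteq S(n)$ with $F(X)=\max_{Y\in\mathcal{K}}\langle Y,X\rangle$ for all $X$; when $F$ is uniformly elliptic, every $Z\in\mathcal{K}$ is positive definite. $\sqrt{Z}$ denotes the unique symmetric positive definite square root of $Z$. A viscosity supersolution of $F(\mathcal{H}w)=0$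 in $\Omega$ is a function $u\colon\Omega\to(-\infty,\infty]$ that is lower semicontinuous, finite on a dense subset of $\Omega$, and such that whenever $x_0\in\Omega$ and a $C^2$ function $\phi$ satisfies $\phi(x_0)=u(x_0)$ and $\phi\leq u$ near $x_0$, then $F(\mathcal{H}\phi(x_0))\leq 0$. Superharmonic means viscosity supersolution of $\Delta w=\operatorname{tr}(\mathcal{H}w)=0$. *)

(* Defs.v *)
From HB Require Import structures.
From mathcomp Require Export all_boot all_order all_algebra.
From mathcomp Require Export all_classical all_reals all_analysis.
Set Implicit Arguments.
Unset Strict Implicit.
Unset Printing Implicit Defensive.
Import Order.TTheory GRing.Theory Num.Theory.
Import numFieldNormedType.Exports.
Local Open Scope classical_set_scope.
Local Open Scope ring_scope.

(* S(n) is the set of symmetric matrices inside 'M[R]_n.  An operator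
   F : S(n) -> R is a function on 'M[R]_n of which only the values at
   symmetric matrices are constrained by the predicates below. *)
Definition frobenius (R : realType) (n : nat) (X Y : 'M[R]_n) : R :=
  \tr (X *m Y).

Definition quadform (R : realType) (n : nat) (X : 'M[R]_n) (xi : 'cV[R]_n) : R :=
  (xi^T *m X *m xi) 0 0.

Definition loewner_le (R : realType) (n : nat) (X Y : 'M[R]_n) : Prop :=
  forall xi : 'cV[R]_n, quadform X xi <= quadform Y xi.

Definition posdefmx (R : realType) (n : nat) (X : 'M[R]_n) : Prop :=
  X \is symmetricmx /\ forall xi : 'cV[R]_n, xi != 0 -> 0 < quadform X xi.

(* The symmetric positive definite square root of a positive definite Z; the
   junk value 0 is returned when there is none. *)
Definition sqrtmx (R : realType) (n : nat) (Z : 'M[R]_n) : 'M[R]_n :=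
  xget 0 [set S : 'M[R]_n | posdefmx S /\ S *m S = Z].

Definition sublinear (R : realType) (n : nat) (F : 'M[R]_n -> R) : Prop :=
  (forall X Y : 'M[R]_n, X \is symmetricmx -> Y \is symmetricmx ->
     F (X + Y) <= F X + F Y) /\
  (forall (t : R) (X : 'M[R]_n), 0 <= t -> X \is symmetricmx ->
     F (t *: X) = t * F X).

Definition uniformly_elliptic (R : realType) (n : nat) (F : 'M[R]_n -> R) : Prop :=
  exists lam Lam : R, [/\ 0 < lam, lam <= Lam &
    forall X A : 'M[R]_n, X \is symmetricmx -> A \is symmetricmx ->
      loewner_le 0 A ->
      lam * \tr A <= F (X + A) - F X /\ F (X + A) - F X <= Lam * \tr A].

(* K, a subset of S(n), is the convex body whose support function is F; the
   last clause says that F X is the maximum of <Y, X> over Y in K. *)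
Definition associated_body (R : realType) (n : nat) (F : 'M[R]_n -> R)
    (K : set 'M[R]_n) : Prop :=
  [/\ K `<=` [set X : 'M[R]_n | X \is symmetricmx],
      K !=set0, compact K, convex_set (K : set (convex_lmodType 'M[R]_n)) &
      forall X : 'M[R]_n, X \is symmetricmx ->
        (exists2 Y, K Y & F X = frobenius Y X) /\
        (forall Y, K Y -> frobenius Y X <= F X)].

Definition partial (R : realType) (n : nat) (i : 'I_n) (f : 'cV[R]_n -> R) :
    'cV[R]_n -> R :=
  fun x => 'D_(delta_mx i 0) f x.

Definition hessian (R : realType) (n : nat) (f : 'cV[R]_n -> R)
    (x : 'cV[R]_n) : 'M[R]_n :=
  \matrix_(i, j) partial j (partial i f) x.

(* The operator 'D_v f is total, so the existence of the partial derivatives is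
   required separately from their continuity. *)
Definition C2_near (R : realType) (n : nat) (f : 'cV[R]_n -> R)
    (x0 : 'cV[R]_n) : Prop :=
  \forall x \near x0,
    [/\ {for x, continuous f},
        forall i : 'I_n, derivable f x (delta_mx i 0) /\
          {for x, continuous (partial i f)} &
        forall i j : 'I_n, derivable (partial i f) x (delta_mx j 0) /\
          {for x, continuous (partial j (partial i f))}].

(* Only the values of u on Omega matter: lower semicontinuity is relative to the
   subspace topology, for which the points outside Omega are isolated, and
   Omega is meant to be open. *)
Definition visc_supersolution (R : realType) (n : nat) (F : 'M[R]_n -> R)
    (Omega : set 'cV[R]_n) (u : 'cV[R]_n -> \bar R) : Prop :=
  [/\ forall x, Omega x -> (-oo < u x)%E,
      lower_semicontinuous (u : subspace Omega -> \bar R),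
      Omega `<=` closure (Omega `&` [set x | u x \is a fin_num]) &
      forall (x0 : 'cV[R]_n) (phi : 'cV[R]_n -> R), Omega x0 ->
        C2_near phi x0 -> (phi x0)%:E = u x0 ->
        (\forall x \near x0, ((phi x)%:E <= u x)%E) ->
        F (hessian phi x0) <= 0].

Definition superharmonic (R : realType) (n : nat) (Omega : set 'cV[R]_n)
    (u : 'cV[R]_n -> \bar R) : Prop :=
  visc_supersolution (fun X : 'M[R]_n => \tr X) Omega u.

(* Main.v *)
Require Import Defs.
From mathcomp Require Import complex ring lra.
Import Order.TTheory GRing.Theory Num.Theory.
Import numFieldNormedType.Exports.
Local Open Scope classical_set_scope.
Local Open Scope ring_scope.

(* A C^2 function phi touching u from below at x0 may be replaced by the quadratic
   polynomial q with the same value and gradient at x0 and with Hessian H - e 1,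
   where H is the Hessian of phi at x0; the error e is sent to 0 at the end. For
   quadratic polynomials the linear change of variables x -> sqrt(Z) x acts on
   Hessians by M |-> sqrt(Z) M sqrt(Z), whose trace is <Z, M>. So superharmonicity
   of u_Z says that <Z, H> <= 0 for all test Hessians H of u, and the maximum of
   <Z, H> over the Z in K is F H. That F H is such a maximum requires H to be
   symmetric, which is where Schwarz's theorem enters. *)

(** * Directional derivatives and the mean value theorem *)

Lemma near_translate {R : realType} {V : normedModType R} (x : V) (P : set V) :
  (\forall y \near x, P y) <->
  exists2 d : R, 0 < d & forall h, `|h| < d -> P (x + h).
Proof.
split=> [/nbhs_normP[d /= d0 dP]|[d d0 dP]].
  exists d => // h hd; apply: dP => /=.
  by rewrite /ball_ /= opprD addNKr normrN.
apply/nbhs_normP; exists d => //= y /=; rewrite /ball_ /= distrC => yd.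
by have := dP _ yd; rewrite addrC subrK.
Qed.

Section directional.
Context {R : realType} {V : normedModType R}.
Implicit Types (f : V -> R) (x y u v : V).

Lemma is_derive_line f x v (t : R) : derivable f (x + t *: v) v ->
  is_derive t (1 : R) (fun s : R => f (x + s *: v)) ('D_v f (x + t *: v)).
Proof.
move=> df.
have E : (fun h : R => h^-1 *: (((fun s => f (x + s *: v)) \o shift t) (h *: 1)
    - f (x + t *: v))) =
  (fun h => h^-1 *: ((f \o shift (x + t *: v)) (h *: v) - f (x + t *: v))).
  apply/funext => h /=; congr (_ *: (f _ - _)).
  by rewrite scalerDl addrCA (_ : (h *: 1 : R^o) = h) // /GRing.scale /= mulr1.
by apply: DeriveDef; rewrite /derivable /derive E.
Qed.

(** The segment from [x] to [x + a *: v] is parametrised by [s] in [[0, 1]], so that [a] may have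
    either sign or vanish. *)
Lemma MVT_scale f x v (a : R) :
  (forall s, 0 <= s <= 1 -> derivable f (x + (s * a) *: v) v) ->
  exists2 s, 0 <= s <= 1 & f (x + a *: v) - f x = a * 'D_v f (x + (s * a) *: v).
Proof.
move=> df.
pose g (s : R) := f (x + (s * a) *: v).
have dg (s : R) : 0 <= s <= 1 -> is_derive s (1 : R) g ('D_v f (x + (s * a) *: v) * a).
  move=> /df /is_derive_line dfs.
  have -> : g = (fun s => f (x + s *: v)) \o (fun s : R => s * a) by [].
  apply: is_derive1_comp => //.
  have : is_derive s (1 : R) (a *: (id : R -> R)) (a *: 1) by apply: is_deriveZ.
  rewrite /GRing.scale /= mulr1; congr (is_derive _ _ _ _).
  by apply/funext => r; rewrite /= mulrC.
have [||s s01 E] := @MVT_segment R g (fun s => 'D_v f (x + (s * a) *: v) * a) 0 1 ler01.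
- by move=> s; rewrite in_itv /= => /andP[/ltW s0 /ltW s1]; apply: dg; rewrite s0.
- apply: derivable_within_continuous => s; rewrite in_itv /= => /dg [] //.
exists s; first by move: s01; rewrite in_itv.
by move: E; rewrite /g mul1r mul0r scale0r addr0 subr0 mulr1 mulrC.
Qed.

Lemma is_derive_translate f (c x v : V) : derivable f (x + c) v ->
  is_derive x v (fun y => f (y + c)) ('D_v f (x + c)).
Proof.
move=> df.
have E : (fun h : R => h^-1 *: (((fun y => f (y + c)) \o shift x) (h *: v)
    - f (x + c))) =
  (fun h => h^-1 *: ((f \o shift (x + c)) (h *: v) - f (x + c))).
  by apply/funext => h /=; rewrite addrA.
by apply: DeriveDef; rewrite /derivable /derive E.
Qed.

(** The mixed difference is the increment along [u] of [g y = f (y + t *: v) - f y]. The mean value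
    theorem along [u] turns it into an increment of ['D_u f] along [v], to which the theorem is
    applied again. *)
Lemma second_difference f x u v (t : R) :
  (forall a b, 0 <= a <= 1 -> 0 <= b <= 1 ->
     derivable f (x + (a * t) *: u + (b * t) *: v) u /\
     derivable ('D_u f) (x + (a * t) *: u + (b * t) *: v) v) ->
  exists a b, [/\ 0 <= a <= 1, 0 <= b <= 1 &
    f (x + t *: u + t *: v) - f (x + t *: u) - (f (x + t *: v) - f x) =
    t * t * 'D_v ('D_u f) (x + (a * t) *: u + (b * t) *: v)].
Proof.
move=> df.
pose g y := f (y + t *: v) - f y.
have I0 : 0 <= (0 : R) <= 1 by rewrite lexx ler01.
have I1 : 0 <= (1 : R) <= 1 by rewrite lexx ler01.
have dg s : 0 <= s <= 1 -> is_derive (x + (s * t) *: u) u g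
  ('D_u f (x + (s * t) *: u + t *: v) - 'D_u f (x + (s * t) *: u)).
  move=> s01; apply: is_deriveB; last first.
    by apply: DeriveDef => //; have [] := df s 0 s01 I0; rewrite mul0r scale0r addr0.
  by apply: is_derive_translate; have [] := df s 1 s01 I1; rewrite mul1r.
have [a a01 Ea] := MVT_scale g x u t (fun s s01 => @ex_derive _ _ _ _ _ _ _ (dg s s01)).
have [b b01 Eb] := MVT_scale ('D_u f) (x + (a * t) *: u) v t
  (fun b b01 => (df a b a01 b01).2).
exists a, b; split => //.
move: Ea; rewrite /g => ->.
by rewrite (@derive_val _ _ _ _ _ _ _ (dg a a01)) Eb mulrA.
Qed.

End directional.

(** * Twice continuously differentiable functions *)

Section calculus.
Context {R : realType} {n : nat}.
Implicit Types (f phi : 'cV[R]_n -> R) (x v h : 'cV[R]_n).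

(* The increment along v is split into increments along the coordinate axes, one
   for each index in r, so that the mean value theorem applies to each. *)
Lemma C1_increment f x v (r : seq 'I_n) (e : R) : 0 < e ->
  (\forall y \near x, forall i, derivable f y (delta_mx i 0)) ->
  (forall i, {for x, continuous (partial i f)}) ->
  \forall t \near (0 : R),
    `|f (x + t *: \sum_(i <- r) v i 0 *: delta_mx i 0) - f x -
      t * \sum_(i <- r) v i 0 * partial i f x| <= e * `|t|.
Proof.
move=> + df cf; elim: r e => [|i r IHr] e e0.
  by near=> t; rewrite !big_nil scaler0 addr0 mulr0 subrr subr0 normr0 mulr_ge0// ltW.
pose w := \sum_(i <- r) v i 0 *: delta_mx i 0 : 'cV[R]_n.
have e20 : 0 < e / 2 by rewrite divr_gt0.
(* The error in [partial i f] gets multiplied by [v i 0], and the product must stay below [e / 2];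
   the [+ 1] keeps the denominator positive. *)
have c0 : 0 < e / 2 / (`|v i 0| + 1) by rewrite divr_gt0// ltr_wpDl.
have : \forall y \near x, derivable f y (delta_mx i 0) /\
    `|partial i f x - partial i f y| <= e / 2 / (`|v i 0| + 1).
  have /cvgrPdist_le /(_ _ c0) ci := cf i.
  by near=> y; split; [exact: (near df) | exact: (near ci)].
move=> /near_translate[d d0 dP].
(* [C] bounds the displacement per unit of [t], so [|t| < d / C] keeps every intermediate point
   within [d] of [x]. *)
pose C := `|w| + `|v i 0 *: (delta_mx i 0 : 'cV[R]_n)| + 1.
have C0 : 0 < C by rewrite ltr_wpDl// addr_ge0.
have {}dP t s : `|t| < d / C -> 0 <= s <= 1 ->
  let y := x + t *: w + (s * (t * v i 0)) *: delta_mx i 0 in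
  derivable f y (delta_mx i 0) /\
    `|partial i f x - partial i f y| <= e / 2 / (`|v i 0| + 1).
  move=> td /andP[s0 s1] /=; rewrite -addrA; apply: dP.
  rewrite mulrCA -scalerA -scalerDr normrZ.
  have : `|w + (s * v i 0) *: (delta_mx i 0 : 'cV[R]_n)| <= C.
    rewrite (le_trans (ler_normD _ _))// /C -addrA lerD2l.
    rewrite -scalerA normrZ ger0_norm// -[leLHS]addr0 lerD//.
    by rewrite ler_piMl.
  move=> /(ler_wpM2l (normr_ge0 t)) /le_lt_trans; apply.
  by rewrite -ltr_pdivlMr.
have Ht : \forall t \near (0 : R), `|t| < d / C.
  by apply: nbhs0_lt; exact: divr_gt0.
near=> t; have td : `|t| < d / C by exact: (near Ht).
rewrite !big_cons -/w.
have [|s s01 E] := MVT_scale f (x + t *: w) (delta_mx i 0) (t * v i 0).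
  by move=> s /(dP _ _ td)[].
have [_ Ps] := dP t s td s01.
have IH : `|f (x + t *: w) - f x - t * \sum_(j <- r) v j 0 * partial j f x|
   <= e / 2 * `|t| by near: t; apply: IHr.
rewrite mulrDr; set S := t * \sum_(j <- r) _ in IH *.
have -> : x + t *: (v i 0 *: delta_mx i 0 + w) = x + t *: w + (t * v i 0) *: delta_mx i 0.
  by rewrite scalerDr scalerA addrAC addrA.
set y := x + t *: w + _ in Ps.
(* The error splits into that of the remaining coordinates, bounded by induction, and that of the
   step along coordinate [i]; each gets [e / 2]. *)
have -> : f (x + t *: w + (t * v i 0) *: delta_mx i 0) - f x -
    (t * (v i 0 * partial i f x) + S) =
   (f (x + t *: w) - f x - S) + t * (v i 0 * (partial i f y - partial i f x)).
  have -> : f (x + t *: w + (t * v i 0) *: delta_mx i 0) = f (x + t *: w) +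
     t * v i 0 * partial i f y by rewrite -[LHS](subrK (f (x + t *: w))) E addrC.
  by ring.
rewrite (le_trans (ler_normD _ _))// [e]splitr mulrDl lerD//.
rewrite normrM mulrC ler_wpM2r// normrM distrC.
rewrite (le_trans (ler_wpM2l _ Ps))// mulrCA ler_piMr ?(ltW e20)//.
by rewrite ler_pdivrMr ?ltr_wpDl// mul1r lerDl.
Unshelve. all: by end_near. Qed.

Lemma sum_delta_mx (v : 'cV[R]_n) : \sum_i v i 0 *: delta_mx i 0 = v.
Proof. by rewrite [RHS]matrix_sum_delta; apply: eq_bigr => i _; rewrite big_ord1. Qed.

(** This is [C1_increment] over all coordinates, divided by [t]. *)
Lemma C1_derive f x v :
  (\forall y \near x, forall i, derivable f y (delta_mx i 0)) ->
  (forall i, {for x, continuous (partial i f)}) ->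
  is_derive x v f (\sum_i v i 0 * partial i f x).
Proof.
move=> df cf; set D := \sum_i _.
suff H : h^-1 *: ((f \o shift x) (h *: v) - f x) @[h --> 0^'] --> D.
  by apply: DeriveDef; [apply/cvg_ex; exists D | exact: cvg_lim].
apply/cvgrPdist_le => e e0; near=> t.
have t0 : t != 0 by near: t; exact: nbhs_dnbhs_neq.
have : `|f (x + t *: \sum_i v i 0 *: delta_mx i 0) - f x -
      t * \sum_i v i 0 * partial i f x| <= e * `|t|.
  by near: t; apply: nbhs_dnbhs; exact: C1_increment.
rewrite sum_delta_mx -/D /= addrC => H.
rewrite /GRing.scale /= [x + _]addrC in H *.
have -> : D - t^-1 * (f (t *: v + x) - f x) = - t^-1 * (- (t * D) + (f (t *: v + x) - f x)).
  by field.
by rewrite normrM normrN normfV mulrC ler_pdivrMr ?normr_gt0.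
Unshelve. all: by end_near. Qed.

(** The second difference over the parallelogram spanned by [t *: delta_mx i 0] and
    [t *: delta_mx j 0] is symmetric in [i] and [j]. By [second_difference] it is [t * t] times
    either mixed derivative at some nearby point, and continuity at [x] brings both values within
    [e / 2] of those at [x]. *)
Lemma schwarz f x i j :
  C2_near f x -> partial j (partial i f) x = partial i (partial j f) x.
Proof.
move=> C2; apply/eqP; rewrite -subr_eq0 -normr_le0; apply/ler_addgt0Pl => e e0.
have cij k l : {for x, continuous (partial k (partial l f))}.
  by have [_ _ H] := nbhs_singleton C2; case: (H l k).
rewrite addr0; have e20 : 0 < e / 2 by rewrite divr_gt0.
have : \forall y \near x, [/\ forall k, derivable f y (delta_mx k 0),
   forall k l, derivable (partial k f) y (delta_mx l 0) &
   `|partial j (partial i f) x - partial j (partial i f) y| <= e / 2 /\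
   `|partial i (partial j f) x - partial i (partial j f) y| <= e / 2].
  have /cvgrPdist_le /(_ _ e20) c1 := cij j i.
  have /cvgrPdist_le /(_ _ e20) c2 := cij i j.
  near=> y; have [_ H1 H2] : [/\ {for y, continuous f},
        forall i : 'I_n, derivable f y (delta_mx i 0) /\
          {for y, continuous (partial i f)} &
        forall i j : 'I_n, derivable (partial i f) y (delta_mx j 0) /\
          {for y, continuous (partial j (partial i f))}] by near: y; exact: C2.
  split; [by move=> k; case: (H1 k) | by move=> k l; case: (H2 k l) |].
  by split; [exact: (near c1) | exact: (near c2)].
move=> /near_translate[d d0 dP].
pose N k := `|delta_mx k 0 : 'cV[R]_n|.
(* With [t * C < d], all points of the parallelogram lie within [d] of [x]; the [+ 1] ensures
   [C > 0]. *)
pose C := N i + N j + 1.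
have N0 k : 0 <= N k by exact: normr_ge0.
have C0 : 0 < C by rewrite ltr_wpDl// addr_ge0.
have [t t0 tC] : exists2 t, 0 < t & t * C < d.
  by exists (d / 2 / C); rewrite ?divr_gt0// divfK ?gt_eqF//; lra.
have bound k l a b : 0 <= a <= 1 -> 0 <= b <= 1 -> N k + N l + 1 = C ->
    `|(a * t) *: (delta_mx k 0 : 'cV[R]_n) + (b * t) *: delta_mx l 0| < d.
  move=> /andP[a0 a1] /andP[b0 b1] kl.
  rewrite (le_lt_trans (ler_normD _ _))// !normrZ -/(N k) -/(N l).
  rewrite !ger0_norm ?mulr_ge0 ?(ltW t0)//.
  apply: le_lt_trans tC.
  rewrite -kl !mulrDr; have := ler_wpM2r (N0 k) (ler_wpM2r (ltW t0) a1).
  have := ler_wpM2r (N0 l) (ler_wpM2r (ltW t0) b1); lra.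
have Cji : N j + N i + 1 = C by rewrite /C [N j + _]addrC.
pose at_ k l a b := x + (a * t) *: (delta_mx k 0 : 'cV[R]_n) + (b * t) *: delta_mx l 0.
have dd k l a b : N k + N l + 1 = C -> 0 <= a <= 1 -> 0 <= b <= 1 ->
    derivable f (at_ k l a b) (delta_mx k 0) /\
    derivable (partial k f) (at_ k l a b) (delta_mx l 0).
  move=> kl a01 b01; rewrite /at_ -addrA.
  by have [H1 H2 _] := dP _ (bound k l a b a01 b01 kl).
have mixed k l (kl : N k + N l + 1 = C) : exists a b, [/\ 0 <= a <= 1, 0 <= b <= 1 &
    f (x + t *: delta_mx k 0 + t *: delta_mx l 0) - f (x + t *: delta_mx k 0) -
    (f (x + t *: delta_mx l 0) - f x) = t * t * partial l (partial k f) (at_ k l a b)].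
  exact: second_difference (fun a b => dd k l a b kl).
have [a [b [a01 b01 E1]]] := mixed i j erefl.
have [a' [b' [a'01 b'01 E2]]] := mixed j i Cji.
have [_ _ [+ _]] := dP _ (bound i j a b a01 b01 erefl).
have [_ _ [_ +]] := dP _ (bound j i a' b' a'01 b'01 Cji).
rewrite !addrA -/(at_ i j a b) -/(at_ j i a' b').
move: E1 E2; rewrite [_ + t *: delta_mx j 0 + _]addrAC.
move: (partial j _ (at_ _ _ _ _)) (partial i _ (at_ _ _ _ _)) => A B E1 E2.
have -> : A = B.
  have tt0 : t * t != 0 by rewrite mulf_neq0 ?gt_eqF.
  by apply: (mulfI tt0); lra.
move: (partial j (partial i f) x) (partial i (partial j f) x) => a1 a2 H1 H2.
by rewrite (le_trans (ler_distD B _ _))// [e]splitr lerD// distrC.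
Unshelve. all: by end_near. Qed.

Lemma hessian_sym f x : C2_near f x -> (hessian f x)^T = hessian f x.
Proof. by move=> C2; apply/matrixP => i j; rewrite !mxE; exact: schwarz. Qed.

Lemma quadformE (M : 'M[R]_n) h :
  quadform M h = \sum_i h i 0 * \sum_j h j 0 * M i j.
Proof.
rewrite /quadform -mulmxA mxE; apply: eq_bigr => i _; rewrite !mxE; congr (_ * _).
by apply: eq_bigr => j _; rewrite mulrC.
Qed.

Lemma quadform1E h : quadform 1%:M h = \sum_i h i 0 ^+ 2.
Proof.
by rewrite /quadform mulmx1 mxE; apply: eq_bigr => i _; rewrite !mxE expr2.
Qed.

(** Each term satisfies [|h_i h_j| <= (h_i^2 + h_j^2) / 2], and summing the right-hand side over all
    [i] and [j] gives [n] times the squared Euclidean norm of [h]. *)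
Lemma quadform_norm_le (M : 'M[R]_n) h (d : R) :
  (forall i j, `|M i j| <= d) -> `|quadform M h| <= d * n%:R * quadform 1%:M h.
Proof.
move=> Md; rewrite quadform1E quadformE.
under eq_bigr do rewrite mulr_sumr.
have -> : d * n%:R * \sum_i h i 0 ^+ 2 =
    \sum_i \sum_j d * ((h i 0 ^+ 2 + h j 0 ^+ 2) / 2).
  set S := \sum_i h i 0 ^+ 2.
  have E i : \sum_(j < n) d * ((h i 0 ^+ 2 + h j 0 ^+ 2) / 2) =
      d / 2 * n%:R * h i 0 ^+ 2 + d / 2 * S.
    rewrite -mulr_sumr -mulr_suml big_split /= -/S sumr_const card_ord -mulr_natr.
    by field.
  under [RHS]eq_bigr do rewrite E.
  rewrite big_split /= -mulr_sumr -/S sumr_const card_ord -[_ *+ n]mulr_natr.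
  by field.
rewrite (le_trans (ler_norm_sum _ _ _))//; apply: ler_sum => i _.
rewrite (le_trans (ler_norm_sum _ _ _))//; apply: ler_sum => j _.
rewrite mulrA normrM [in leLHS]mulrC [`|_ * _|]normrM ler_pM//.
rewrite -[h i 0 ^+ 2]real_normK ?num_real// -[h j 0 ^+ 2]real_normK ?num_real//.
have := sqr_ge0 (`|h i 0| - `|h j 0|); rewrite sqrrB; lra.
Qed.

End calculus.

(** * Quadratic test functions *)

Lemma continuous_mx {R : realType} {m n : nat} {T : topologicalType}
    (f : T -> 'M[R]_(m, n)) :
  (forall i j, continuous (fun x => f x i j)) -> continuous f.
Proof.
move=> cf x A [P Px PA].
apply: (@filterS _ (nbhs x) _ (fun y => forall i j, P i j (f y i j))).
  by move=> y Py; apply: PA.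
apply: filter_forall => i; apply: filter_forall => j.
by have := cf i j x _ (Px i j).
Qed.

Lemma continuous_mulmx {R : realType} {m n p : nat} (A : 'M[R]_(m, n)) :
  continuous (fun x : 'M[R]_(n, p) => A *m x).
Proof.
apply: continuous_mx => i j; under [X in continuous X]eq_fun do rewrite mxE.
apply: (@continuous_big R 'I_n +%R 0 xpredT (@add_continuous R)) => k _ x.
have c1 : {for x, continuous (fun M : 'M[R]_(n, p) => M k j)} by exact: coord_continuous.
have c2 : {for x, continuous (fun=> A i k)} by exact: cst_continuous.
exact: (continuousM c2 c1).
Qed.

Section quadpoly.
Context {R : realType} {n : nat}.
Implicit Types (c : R) (l x v h : 'cV[R]_n) (M S : 'M[R]_n).

Definition quadpoly c l M x0 x : R :=
  c + (l^T *m (x - x0)) 0 0 + 2^-1 * quadform M (x - x0).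

(** The difference quotient is exactly [a + t * b]. The case [b = 0] covers affine functions. *)
Lemma is_derive_quadratic {V : normedModType R} (f : V -> R) (x v : V) (a b : R) :
  (forall t : R, f (t *: v + x) = f x + t * a + t ^+ 2 * b) -> is_derive x v f a.
Proof.
move=> E.
suff H : h^-1 *: ((f \o shift x) (h *: v) - f x) @[h --> 0^'] --> a.
  by apply: DeriveDef; [apply/cvg_ex; exists a | exact: cvg_lim].
have : a + h * b @[h --> (0 : R)^'] --> a + 0 * b.
  apply: cvg_within_filter; apply: cvgD; first exact: cvg_cst.
  by apply: cvgM; [exact: cvg_id | exact: cvg_cst].
rewrite mul0r addr0; apply: cvg_trans; apply: near_eq_cvg.
near=> t; have t0 : t != 0 by near: t; exact: nbhs_dnbhs_neq.
by rewrite /= E /GRing.scale /=; field.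
Unshelve. all: by end_near. Qed.

Lemma is_derive_lincomb {V : normedModType R} (f : 'I_n -> V -> R) (a df : 'I_n -> R)
    (x v : V) : (forall i, is_derive x v (f i) (df i)) ->
  is_derive x v (fun y => \sum_i a i * f i y) (\sum_i a i * df i).
Proof.
move=> D; have := is_derive_sum (fun i => is_deriveZ (a i) (D i)).
by rewrite fct_sumE.
Qed.

Lemma mul_row_colC (u v : 'cV[R]_n) M : (u^T *m M *m v) 0 0 = (v^T *m M^T *m u) 0 0.
Proof.
transitivity ((u^T *m M *m v)^T 0 0); first by rewrite [RHS]mxE.
by rewrite !trmx_mul trmxK mulmxA.
Qed.

Lemma quadformZ M t h : quadform M (t *: h) = t ^+ 2 * quadform M h.
Proof. by rewrite /quadform [(t *: h)^T]linearZ /= -scalemxAr -!scalemxAl !mxE mulrA expr2. Qed.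

Lemma quadformD M h v : M^T = M ->
  quadform M (h + v) = quadform M h + 2 * (v^T *m M *m h) 0 0 + quadform M v.
Proof.
move=> Msym; rewrite /quadform [(h + v)^T]linearD /= !(mulmxDl, mulmxDr) !mxE.
have := mul_row_colC h v M; rewrite Msym !mxE => ->; ring.
Qed.

Lemma is_derive_quadpoly c l M x0 x v : M^T = M ->
  is_derive x v (quadpoly c l M x0)
    ((l^T *m v) 0 0 + (v^T *m M *m (x - x0)) 0 0).
Proof.
move=> Msym; apply: (@is_derive_quadratic _ _ _ _ _ (2^-1 * quadform M v)) => t.
rewrite /quadpoly -[t *: v + x + _]addrA [t *: v + _]addrC (quadformD _ (x - x0))// quadformZ.
by rewrite mulmxDr -scalemxAr [(t *: v)^T]linearZ /= -!scalemxAl !mxE; field.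
Qed.

Lemma is_derive_affine c l x0 x v :
  is_derive x v (fun y => c + (l^T *m (y - x0)) 0 0) ((l^T *m v) 0 0).
Proof.
apply: (@is_derive_quadratic _ _ _ _ _ 0) => t.
rewrite -[t *: v + x + _]addrA [t *: v + _]addrC mulmxDr -scalemxAr !mxE; ring.
Qed.

(* The double transpose gives the right-hand side the shape l^T *m (x - x0) of
   [is_derive_affine]. *)
Lemma partial_quadpoly c l M x0 i : M^T = M ->
  partial i (quadpoly c l M x0) =
  fun x => l i 0 + ((row i M)^T^T *m (x - x0)) 0 0.
Proof.
move=> Msym; apply/funext => x.
have H := is_derive_quadpoly c l M x0 x (delta_mx i 0) Msym.
rewrite /partial derive_val trmx_delta -rowE trmxK; congr (_ + _).
rewrite mxE (bigD1 i)//= !mxE !eqxx mulr1 big1 ?addr0// => j ji.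
by rewrite !mxE (negbTE ji) mulr0.
Qed.

Lemma partial2_quadpoly c l M x0 i j : M^T = M ->
  partial j (partial i (quadpoly c l M x0)) = cst (M i j).
Proof.
move=> Msym; rewrite partial_quadpoly//; apply/funext => x.
have H := is_derive_affine (l i 0) (row i M)^T x0 x (delta_mx j 0).
rewrite /partial derive_val trmxK mxE (bigD1 j)//= !mxE !eqxx mulr1.
by rewrite big1 ?addr0// => k kj; rewrite !mxE (negbTE kj) mulr0.
Qed.

Lemma hessian_quadpoly c l M x0 x : M^T = M -> hessian (quadpoly c l M x0) x = M.
Proof. by move=> Msym; apply/matrixP => i j; rewrite mxE partial2_quadpoly. Qed.

Lemma continuous_mulmx_coord m (A : 'M[R]_(m, n)) i :
  continuous (fun x : 'cV[R]_n => (A *m x) i 0).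
Proof.
move=> x; have c1 : {for x, continuous (mulmx A : 'cV_n -> 'cV_m)}.
  exact: continuous_mulmx.
have c2 : {for A *m x, continuous (fun y : 'cV[R]_m => y i 0)}.
  exact: coord_continuous.
exact: (continuous_comp c1 c2).
Qed.

Lemma continuous_quadform M : continuous (quadform M).
Proof.
have -> : quadform M = fun h => \sum_i (h i 0 * (M *m h) i 0).
  by apply/funext => h; rewrite /quadform -mulmxA mxE; apply: eq_bigr => i _; rewrite mxE.
apply: (@continuous_big R 'I_n +%R 0 xpredT (@add_continuous R)) => i _ x.
have c1 : {for x, continuous (fun h : 'cV[R]_n => h i 0)} by exact: coord_continuous.
have c2 : {for x, continuous (fun h : 'cV[R]_n => (M *m h) i 0)}.
  exact: continuous_mulmx_coord.
exact: (continuousM c1 c2).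
Qed.

Lemma continuous_comp_subr (f : 'cV[R]_n -> R) x0 :
  continuous f -> continuous (fun y : 'cV[R]_n => f (y - x0)).
Proof.
move=> cf x.
have c1 : {for x, continuous (fun y : 'cV[R]_n => y - x0)}.
  by apply: continuousB; [exact: cvg_id | exact: cst_continuous].
exact: (continuous_comp c1 (cf (x - x0))).
Qed.

Lemma continuous_affine c l x0 : continuous (fun y : 'cV[R]_n => c + (l^T *m (y - x0)) 0 0).
Proof.
move=> x; have c1 : {for x, continuous (fun=> c)} by exact: cst_continuous.
have c2 : {for x, continuous (fun y : 'cV[R]_n => (l^T *m (y - x0)) 0 0)}.
  exact: (continuous_comp_subr (fun y => (l^T *m y) 0 0) x0 (continuous_mulmx_coord _ l^T 0)).
exact: (continuousD c1 c2).
Qed.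

Lemma C2_quadpoly c l M x0 x : M^T = M -> C2_near (quadpoly c l M x0) x.
Proof.
move=> Msym; near=> y; split.
- have c1 : {for y, continuous (fun=> 2^-1 : R)} by exact: cst_continuous.
  have c2 : {for y, continuous (fun z : 'cV[R]_n => quadform M (z - x0))}.
    exact: (continuous_comp_subr (quadform M) x0 (continuous_quadform M)).
  exact: (continuousD (continuous_affine c l x0 y) (continuousM c1 c2)).
- move=> i; split; last by rewrite partial_quadpoly//; exact: continuous_affine.
  by have [] := is_derive_quadpoly c l M x0 y (delta_mx i 0) Msym.
- move=> i j; split; last by rewrite partial2_quadpoly//; exact: cst_continuous.
  rewrite partial_quadpoly//.
  by have [] := is_derive_affine (l i 0) (row i M)^T x0 y (delta_mx j 0).
Unshelve. all: by end_near. Qed.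

(** Since [S *m x - x0 = S *m (x - invmx S *m x0)], quadratic polynomials are stable under the
    change of variables, with the centre pulled back. *)
Lemma quadpoly_comp c l M x0 S x : S \in unitmx ->
  quadpoly c l M x0 (S *m x) =
  quadpoly c (S^T *m l) (S^T *m M *m S) (invmx S *m x0) x.
Proof.
move=> Su; rewrite /quadpoly /quadform.
have -> : S *m x - x0 = S *m (x - invmx S *m x0) by rewrite mulmxBr mulKVmx.
by rewrite !trmx_mul trmxK !mulmxA.
Qed.

Lemma quadpoly_center c l M x0 : quadpoly c l M x0 x0 = c.
Proof. by rewrite /quadpoly /quadform subrr !mulmx0 !mxE mulr0 !addr0. Qed.

(* The Taylor polynomial of order 2, lowered by e/2 |x - x0|^2. Along the segment
   from x0 to x0 + h, two applications of the mean value theorem turn phi - q into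
   a nonnegative multiple of h^T (H(y) - H(x0) + e) h, with y near x0. *)
Lemma quadpoly_le (phi : 'cV[R]_n -> R) x0 (e : R) : 0 < e -> C2_near phi x0 ->
  \forall x \near x0,
    quadpoly (phi x0) (\col_i partial i phi x0)
      (hessian phi x0 - e *: 1%:M) x0 x <= phi x.
Proof.
move=> e0 C2; set l := \col_i _; set H := hessian phi x0.
have C2x0 := nbhs_singleton C2.
have n1_gt0 : 0 < n%:R + 1 :> R by rewrite ltr_wpDl.
(* Chosen so that [c * n <= e]: by [quadform_norm_le], a Hessian error with entries at most [c] is
   then absorbed by the term [e *: 1%:M]. *)
pose c := e / (n%:R + 1); have c0 : 0 < c by rewrite divr_gt0.
have : \forall y \near x0, (forall h,
    is_derive y h phi (\sum_i h i 0 * partial i phi y)) /\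
    (forall i h, is_derive y h (partial i phi)
       (\sum_j h j 0 * partial j (partial i phi) y)) /\
    forall i j, `|partial j (partial i phi) y - H i j| <= c.
  have C2C2 : \forall y \near x0, C2_near phi y by exact: near_join.
  have cH : \forall y \near x0, forall i j,
      `|partial j (partial i phi) y - H i j| <= c.
    apply: (filter_forall (nbhs_filter x0)) => i.
    apply: (filter_forall (nbhs_filter x0)) => j; rewrite mxE.
    have [_ _ /(_ i j)[_ /cvgrPdist_le /(_ _ c0)]] := C2x0.
    by apply: filterS => y; rewrite distrC.
  near=> y; have C2y : C2_near phi y by exact: (near C2C2).
  have [_ C1 C2'] := nbhs_singleton C2y.
  split; [move=> h|split]; last by exact: (near cH).
    apply: C1_derive => [|i]; last by case: (C1 i).
    by apply: filterS C2y => z [_ Hz _] i; case: (Hz i).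
  move=> i h; apply: C1_derive => [|j]; last by case: (C2' i j).
  by apply: filterS C2y => z [_ _ Hz] j; case: (Hz i j).
move=> /near_translate[d d0 dP]; apply/near_translate; exists d => // h hd.
have Msym : (H - e *: 1%:M)^T = H - e *: 1%:M.
  by rewrite [LHS]raddfB /= [(e *: _)^T]linearZ /= trmx1 hessian_sym.
set M := H - _ in Msym *; pose q := quadpoly (phi x0) l M x0.
have hs s : 0 <= s <= 1 -> `|s *: h| < d.
  move=> /andP[s0 s1]; rewrite normrZ ger0_norm// (le_lt_trans _ hd)//.
  by rewrite ler_piMl.
(* The linear part of [q] turns the gradient of [phi] into its increment from [x0], which is what
   the second mean value theorem needs. *)
have dw s : 0 <= s <= 1 -> is_derive (x0 + (s * 1) *: h) h (phi - q)
   (\sum_i h i 0 * (partial i phi (x0 + s *: h) - partial i phi x0)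
     - s * (h^T *m M *m h) 0 0).
  move=> s01; rewrite mulr1.
  have [/(_ h) D1 _] := dP _ (hs _ s01).
  have D2 := is_derive_quadpoly (phi x0) l M x0 (x0 + s *: h) h Msym.
  apply: is_derive_eq (is_deriveB D1 D2) _.
  rewrite addrC [x0 + _]addrC addrK -scalemxAr opprD addrAC; congr (_ + _); last by rewrite mxE.
  rewrite addrC mxE -sumrB; apply: eq_bigr => i _; rewrite !mxE; ring.
have [s s01 Ew] := MVT_scale (phi - q) x0 h 1
  (fun s s01 => @ex_derive _ _ _ _ _ _ _ (dw s s01)).
move: Ew; rewrite scale1r mul1r (@derive_val _ _ _ _ _ _ _ (dw s s01)) => Ew.
have q0 : q x0 = phi x0.
  exact: quadpoly_center.
suff : 0 <= (phi - q) (x0 + h) - (phi - q) x0.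
  have E y : (phi - q) y = phi y - q y by [].
  by rewrite !E q0 subrr subr0 subr_ge0.
rewrite Ew; pose g y := \sum_i h i 0 * partial i phi y.
have dg r : 0 <= r <= 1 -> is_derive (x0 + (r * s) *: h) h g
    (\sum_i h i 0 * (\sum_j h j 0 * partial j (partial i phi) (x0 + (r * s) *: h))).
  move=> r01; have rs : 0 <= r * s <= 1.
    by case/andP: r01 => ? ?; case/andP: s01 => ? ?; rewrite mulr_ge0// mulr_ile1.
  have [_ [D _]] := dP _ (hs _ rs).
  by apply: is_derive_lincomb => i; exact: D.
have [r r01 Eg] := MVT_scale g x0 h s
  (fun s s01 => @ex_derive _ _ _ _ _ _ _ (dg s s01)).
move: Eg; rewrite (@derive_val _ _ _ _ _ _ _ (dg r r01)) /g -sumrB => Eg.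
under eq_bigr do rewrite mulrBr.
rewrite Eg -mulrBr; have /andP[s0 _] := s01; apply: mulr_ge0 => //.
have rs : 0 <= r * s <= 1.
  by case/andP: r01 => ? ?; case/andP: s01 => ? ?; rewrite mulr_ge0// mulr_ile1.
have [_ [_ close]] := dP _ (hs _ rs).
(* [N] is the deviation of the Hessian at the intermediate point from [H]; it remains to see that
   [quadform N h + e * quadform 1%:M h] is nonnegative. *)
pose N := \matrix_(i, j) (partial j (partial i phi) (x0 + (r * s) *: h) - H i j).
have Nc i j : `|N i j| <= c by rewrite mxE.
have -> : \sum_i h i 0 * \sum_j h j 0 * partial j (partial i phi) (x0 + (r * s) *: h) =
    quadform (H + N) h.
  rewrite quadformE; apply: eq_bigr => i _; congr (_ * _); apply: eq_bigr => j _.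
  by rewrite [(H + N) i j]mxE [N i j]mxE addrC subrK.
have -> : (h^T *m M *m h) 0 0 = quadform H h - e * quadform 1%:M h.
  by rewrite /quadform mulmxBr mulmxBl -scalemxAr -scalemxAl !mxE.
have -> : quadform (H + N) h = quadform H h + quadform N h.
  by rewrite /quadform mulmxDr mulmxDl !mxE.
have := quadform_norm_le N h c Nc.
have Q0 : 0 <= quadform 1%:M h by rewrite quadform1E; apply: sumr_ge0 => i _; exact: sqr_ge0.
have ce : c * n%:R <= e.
  by rewrite /c mulrAC ler_pdivrMr// ler_pM2l// lerDl.
have := ler_wpM2r Q0 ce.
move: (quadform N h) (quadform H h) (quadform 1%:M h) (c * n%:R) => a b q1 c1.
by rewrite ler_norml => H1 /andP[H2 H3]; lra.
Unshelve. all: by end_near. Qed.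

End quadpoly.

(** * Square roots of positive definite matrices *)

Section quadform.
Context {R : realType} {n : nat}.
Implicit Types (X Z A B S M : 'M[R]_n) (xi : 'cV[R]_n).

Lemma symmxP M : reflect (M^T = M) (M \is symmetricmx).
Proof.
apply: (iffP (is_hermitianmxP _ _ M)); rewrite expr0 scale1r map_mx_id //.
Qed.

Lemma mxtrace_congr A B : \tr (B^T *m A *m B) = \sum_j quadform A (col j B).
Proof.
apply: eq_bigr => j _; rewrite /quadform !mxE; apply: eq_bigr => k _.
by rewrite !mxE; congr (_ * _); apply: eq_bigr => l _; rewrite !mxE.
Qed.

(* tr (B^T A B) is the sum of the values of A on the columns of B, and the
   hypotheses make it equal to its own opposite. *)
Lemma posdefmx_anticomm A B : posdefmx A -> B^T = - B -> A *m B = - (B *m A) ->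
  B = 0.
Proof.
move=> [Asym Apos] Bskew AB.
have Age0 xi : 0 <= quadform A xi.
  have [->|/Apos/ltW//] := eqVneq xi 0.
  by rewrite /quadform mulmx0 mxE.
have tr0 : \tr (B *m A *m B) = 0.
  suff : \tr (B *m A *m B) = - \tr (B *m A *m B) by move=> E; lra.
  by rewrite -{1}mulmxA AB mulmxN raddfN /= mxtrace_mulC.
have : \sum_j quadform A (col j B) = 0.
  by rewrite -mxtrace_congr Bskew !mulNmx raddfN /= tr0 oppr0.
move=> /eqP; rewrite psumr_eq0// => /allP H.
apply/matrixP => i j; rewrite [RHS]mxE.
have /eqP q0 := H j (mem_index_enum j).
have [/matrixP/(_ i 0)|/Apos] := eqVneq (col j B) 0; first by rewrite !mxE.
by rewrite q0 ltxx.
Qed.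

(** The quadratic form of [A] would vanish at the transpose of a nonzero row of the left kernel. *)
Lemma posdefmx_unit A : posdefmx A -> A \in unitmx.
Proof.
move=> [Asym Apos]; rewrite -row_free_unit -kermx_eq0.
apply/eqP/row_matrixP => i; rewrite row0.
have : row i (kermx A) *m A = 0 by apply/sub_kermxP; exact: row_sub.
set v := row i _ => vA; apply/eqP/negP => /negP v0.
have vT0 : v^T != 0 by rewrite -trmx0 (inj_eq trmx_inj).
by have := Apos _ vT0; rewrite /quadform trmxK vA mul0mx mxE ltxx.
Qed.

End quadform.

Section complexification.
Context {R : realType}.
Local Notation C := R[i].

(** The matrix [A + iB]; real symmetric matrices become Hermitian, and the spectral theorem over the
    complex numbers applies to them. *)
Definition complexmx {m p} (A B : 'M[R]_(m, p)) : 'M[C]_(m, p) :=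
  \matrix_(i, j) (A i j +i* B i j)%C.

Lemma complexmx_inj m p (A B A' B' : 'M[R]_(m, p)) :
  complexmx A B = complexmx A' B' -> A = A' /\ B = B'.
Proof.
move=> /matrixP E; split; apply/matrixP => i j; have := E i j; rewrite !mxE.
  by case.
by case.
Qed.

Lemma complexmx_ReIm m p (T : 'M[C]_(m, p)) :
  T = complexmx (map_mx (@complex.Re R) T) (map_mx (@complex.Im R) T).
Proof. by apply/matrixP => i j; rewrite !mxE; case: (T i j). Qed.

Lemma complexmx_mul m p q (A B : 'M[R]_(m, p)) (A' B' : 'M[R]_(p, q)) :
  complexmx A B *m complexmx A' B' =
  complexmx (A *m A' - B *m B') (A *m B' + B *m A').
Proof.
apply/matrixP => i j; rewrite !mxE -sumrN -!big_split /=.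
elim/big_rec3: _ => // k a b c _ ->; rewrite !mxE.
by apply/eqP; rewrite eq_complex /= !eqxx.
Qed.

Lemma complexmx_adj m p (A B : 'M[R]_(m, p)) :
  map_mx (@Num.conj _) (complexmx A B)^T = complexmx A^T (- B^T).
Proof. by apply/matrixP => i j; rewrite !mxE. Qed.


End complexification.

(** The product regroups as the Hermitian form of [diag_mx s] at [P *m v]. It links positivity of
    the form with positivity of the eigenvalues. *)
Lemma unitary_diag_form {K : numClosedFieldType} {n : nat}
    (P : 'M[K]_n) (s : 'rV[K]_n) (v : 'cV[K]_n) :
  (map_mx (@Num.conj K) v^T *m (map_mx (@Num.conj K) P^T *m diag_mx s *m P) *m v) 0 0 =
  \sum_j s 0 j * `|(P *m v) j 0| ^+ 2.
Proof.
have -> : map_mx (@Num.conj K) v^T *m (map_mx (@Num.conj K) P^T *m diag_mx s *m P) *m v =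
    map_mx (@Num.conj K) (P *m v)^T *m (diag_mx s *m (P *m v)).
  by rewrite trmx_mul map_mxM !mulmxA.
rewrite mul_diag_mx mxE; apply: eq_bigr => j _.
by rewrite !mxE mulrCA normCKC.
Qed.

Section sqrtmx.
Context {R : realType} {n : nat}.
Local Notation C := R[i].

Local Notation adj M := (map_mx (@Num.conj C) M^T).

(** The imaginary part is the difference of the two cross terms, which agree because [Z] is
    symmetric. *)
Lemma complex_quadform (Z : 'M[R]_n) (a b : 'cV[R]_n) : Z^T = Z ->
  (adj (complexmx a b) *m complexmx Z 0 *m complexmx a b) 0 0 =
  (quadform Z a + quadform Z b)%:C%C.
Proof.
move=> Zsym; rewrite complexmx_adj !complexmx_mul.
rewrite !(mulmx0, mul0mx, mulNmx, addr0, add0r, subr0, mulmxDl, mulmxBl, opprK).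
rewrite mxE /quadform; apply/eqP; rewrite eq_complex /= !mxE eqxx /= subr_eq0.
have : (a^T *m Z *m b)^T = b^T *m Z *m a.
  by rewrite !trmx_mul trmxK Zsym mulmxA.
by move=> /matrixP/(_ 0 0); rewrite !mxE => ->.
Qed.

(** [Z] is diagonalised over the complex numbers, square roots of its positive eigenvalues are
    taken, and the resulting Hermitian root is shown to be real. *)
Lemma posdefmx_sqrt_exists (Z : 'M[R]_n) : posdefmx Z ->
  exists S : 'M[R]_n, posdefmx S /\ S *m S = Z.
Proof.
move=> [/symmxP Zsym Zpos].
pose Zc := complexmx Z 0.
have Zherm : adj Zc = Zc by rewrite complexmx_adj trmx0 oppr0 Zsym.
have /hermitian_normalmx/orthomx_spectralP : Zc \is hermsymmx.
  by apply/is_hermitianmxP; rewrite expr0 scale1r Zherm.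
set P := spectralmx _; set d := spectral_diag _.
have Pu : P \is unitarymx by exact: spectral_unitarymx.
rewrite invmx_unitary // => ZE.
have PP : P *m adj P = 1%:M by exact/unitarymxP.
have d_gt0 j : 0 < d 0 j.
  (* [v] is a unit eigenvector for [d 0 j], so the form of [Z] at [v] is [d 0 j]; it is positive
     because the real or the imaginary part of [v] is nonzero. *)
  pose v := adj P *m delta_mx j 0 : 'cV[C]_n.
  have : (adj v *m Zc *m v) 0 0 = d 0 j.
    have -> : (adj v *m Zc *m v) 0 0 = \sum_k d 0 k * `|(P *m v) k 0| ^+ 2.
      by rewrite ZE; have := unitary_diag_form P d v.
    rewrite mulmxA PP mul1mx (bigD1 j)//= mxE !eqxx.
    rewrite normr1 expr1n mulr1 big1 ?addr0// => k kj.
    by rewrite mxE (negbTE kj) normr0 expr0n mulr0.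
  move=> <-; have v0 : v != 0.
    apply/eqP => /(congr1 (fun w => (P *m w) j 0)).
    by rewrite mulmxA PP mul1mx mulmx0 !mxE !eqxx => /eqP; rewrite oner_eq0.
  move: v0; rewrite [v]complexmx_ReIm.
  set a := map_mx _ _; set b := map_mx _ _ => ab0.
  rewrite complex_quadform // ltcR.
  have q0 x : 0 <= quadform Z x.
    have [->|/Zpos/ltW//] := eqVneq x 0.
    by rewrite /quadform mulmx0 mxE.
  have [a0|/Zpos ?] := eqVneq a 0; last by rewrite ltr_wpDr.
  rewrite ltr_wpDl// Zpos//; apply: contra_neq ab0 => ->.
  by rewrite a0; apply/matrixP => k l; rewrite !mxE.
pose s := map_mx sqrtC d; pose T := adj P *m diag_mx s *m P.
have s_gt0 j : 0 < s 0 j by rewrite mxE sqrtC_gt0.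
have TT : T *m T = Zc.
  rewrite /T ZE !mulmxA -[_ *m P *m adj P]mulmxA PP mulmx1.
  congr (_ *m _); rewrite -mulmxA mulmx_diag; congr (_ *m diag_mx _).
  by apply/rowP => j; rewrite !mxE -expr2 sqrtCK.
have Therm : adj T = T.
  rewrite /T !trmx_mul !map_mxM -!mulmxA; congr (_ *m (_ *m _)).
    rewrite tr_diag_mx map_diag_mx; congr diag_mx.
    by apply/rowP => j; rewrite mxE; apply/CrealP/ger0_real/ltW.
  by rewrite map_trmx trmxK -map_mx_comp map_mx_id//; exact: conjCK.
have Tpos (v : 'cV[C]_n) : v != 0 -> 0 < (adj v *m T *m v) 0 0.
  move=> v0; have -> : (adj v *m T *m v) 0 0 = \sum_k s 0 k * `|(P *m v) k 0| ^+ 2.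
    by have := unitary_diag_form P s v.
  have Pv0 : P *m v != 0.
    apply: contra_neq v0 => Pv; rewrite -[v]mul1mx.
    by rewrite -(mulmx1C PP) -mulmxA Pv mulmx0.
  have /cV0Pn[j Pvj] := Pv0.
  rewrite (bigD1 j)//= ltr_wpDr//; last by rewrite mulr_gt0 ?exprn_gt0 ?normr_gt0.
  by apply: sumr_ge0 => k _; rewrite mulr_ge0 ?exprn_ge0// ltW.
(* The Hermitian root T = A + iB of the real matrix Z is in fact real: the
   imaginary part of T^2 = Z says that A and B anticommute. *)
move: TT Therm Tpos; rewrite [T]complexmx_ReIm.
set A := map_mx _ _; set B := map_mx _ _.
rewrite complexmx_mul complexmx_adj.
move=> /complexmx_inj[EZ AB0] /complexmx_inj[Asym Bskew] Tpos.
(* On a real vector the real part of the Hermitian form of [T] is the quadratic form of [A]. *)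
have Apos : posdefmx A.
  split=> [|x x0]; first exact/symmxP.
  have := Tpos (complexmx x 0).
  rewrite complexmx_adj !complexmx_mul.
  rewrite !(mulmx0, mul0mx, mulNmx, trmx0, oppr0, addr0, add0r, subr0) mxE ltcE /=.
  move=> /(_ _)/andP[|_]; last by [].
  apply: contra_neq x0 => /matrixP E; apply/matrixP => k l.
  by have := E k l; rewrite !mxE; case.
have B0 : B = 0.
  apply: posdefmx_anticomm Apos _ _; first by rewrite -{2}Bskew opprK.
  by apply/eqP; rewrite -addr_eq0 AB0.
by exists A; split => //; rewrite -EZ B0 mulmx0 subr0.
Qed.

(** Existence of a root rules out the default value [0] of [sqrtmx]. *)
Lemma sqrtmxP (Z : 'M[R]_n) : posdefmx Z ->
  posdefmx (sqrtmx Z) /\ sqrtmx Z *m sqrtmx Z = Z.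
Proof.
move=> Zpos; exact: (@xgetPex _ 0 [set S : 'M[R]_n | posdefmx S /\ S *m S = Z]
  (posdefmx_sqrt_exists _ Zpos)).
Qed.

End sqrtmx.

(** * Linear changes of variables *)

(** Take [A = xi *m xi^T]. Ellipticity from [- A] to [0] gives [F (- A) <= - lam * \tr A], while [Z]
    in [K] gives [- quadform Z xi <= F (- A)]; hence [quadform Z xi >= lam * \tr A > 0]. *)
Lemma body_posdefmx {R : realType} {n : nat} {F : 'M[R]_n -> R} {K : set 'M[R]_n}
    {Z : 'M[R]_n} :
  sublinear F -> uniformly_elliptic F -> associated_body F K -> K Z -> posdefmx Z.
Proof.
move=> [_ F_hom] [lam [Lam [lam0 _ F_ell]]] [Ksym _ _ _ FK] KZ.
split=> [|xi xi0]; first exact: Ksym.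
pose A := xi *m xi^T.
have Asym : A \is symmetricmx by apply/symmxP; rewrite trmx_mul trmxK.
have NAsym : - A \is symmetricmx by apply/symmxP; rewrite raddfN /= (symmxP _ Asym).
have A0 : loewner_le 0 A.
  move=> y; rewrite /quadform mulmx0 mul0mx [leLHS]mxE /A mulmxA -mulmxA mxE big_ord1.
  have -> : (xi^T *m y) 0 0 = (y^T *m xi) 0 0.
    by rewrite -[y^T *m xi]trmxK trmx_mul trmxK [RHS]mxE.
  exact: sqr_ge0.
have F0 : F 0 = 0.
  have sym0 : (0 : 'M[R]_n) \is symmetricmx by apply/symmxP; rewrite trmx0.
  by have := F_hom 0 0 (lexx 0) sym0; rewrite scaler0 mul0r.
have [+ _] := F_ell _ _ NAsym Asym A0; rewrite addNr F0 sub0r.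
have [_ /(_ _ KZ)] := FK _ NAsym.
have -> : frobenius Z (- A) = - quadform Z xi.
  by rewrite /frobenius /A mulmxN raddfN /= mulmxA mxtrace_mulC mulmxA /mxtrace big_ord1.
have trA : 0 < \tr A.
  rewrite /A mxtrace_mulC /mxtrace big_ord1 mxE.
  have /cV0Pn[i xii] := xi0.
  rewrite (bigD1 i)//= mxE ltr_pwDl//; first by rewrite -expr2 exprn_even_gt0.
  by apply: sumr_ge0 => k _; rewrite mxE -expr2 sqr_ge0.
have := mulr_gt0 lam0 trA; lra.
Qed.

Section linear_change.
Context {R : realType} {n : nat}.
Implicit Types (A : 'M[R]_n) (x : 'cV[R]_n) (Omega : set 'cV[R]_n) (u : 'cV[R]_n -> \bar R).

Lemma near_mulmx A x (P : set 'cV[R]_n) :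
  (\forall y \near A *m x, P y) -> \forall z \near x, P (A *m z).
Proof. by move=> H; exact: (@continuous_mulmx R n n 1 A x P H). Qed.

Lemma lower_semicontinuous_mulmx Omega u A :
  lower_semicontinuous (u : subspace Omega -> \bar R) ->
  lower_semicontinuous ((fun x => u (A *m x)) :
    subspace [set x | Omega (A *m x)] -> \bar R).
Proof.
move=> lsc x a au; have [V nV HV] := lsc (A *m x) a au.
exists [set y | V (A *m y)]; last by move=> y; exact: HV.
(* Inside [Omega], relative neighbourhoods are pulled back by continuity; outside, points are
   isolated in both subspace topologies. *)
move: nV; case: (nbhs_subspaceP Omega (A *m x)) => Ox nV.
  rewrite /nbhs /= -nbhs_subspace_in//; exact: near_mulmx nV.
by rewrite /nbhs /= -nbhs_subspace_out// => y ->; exact: nV.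
Qed.

Lemma closure_mulmx Omega (D : set 'cV[R]_n) A : A \in unitmx ->
  Omega `<=` closure D ->
  [set x | Omega (A *m x)] `<=` closure [set x | D (A *m x)].
Proof.
move=> Au OD x /OD Ax V nV.
have : nbhs (A *m x) [set y | V (invmx A *m y)].
  by apply: near_mulmx; rewrite mulKmx.
by move=> /Ax[y [Dy Vy]]; exists (invmx A *m y) => //=; split => //; rewrite /= mulKVmx.
Qed.

(** Information on [u] composed with [A] is carried back to test functions of [u]. Both directions
    of the theorem use it: with [A] the inverse of [sqrtmx Z] and [G = F], and with [A = sqrtmx Z]
    and [G] the trace. *)
Lemma visc_supersolution_quadpoly (G : 'M[R]_n -> R) Omega u A x phi (e : R) :
  A \in unitmx ->
  visc_supersolution G [set x | Omega (A *m x)] (fun x => u (A *m x)) ->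
  Omega x -> C2_near phi x -> (phi x)%:E = u x ->
  (\forall y \near x, ((phi y)%:E <= u y)%E) -> 0 < e ->
  G (A^T *m (hessian phi x - e *: 1%:M) *m A) <= 0.
Proof.
move=> Au [_ _ _ test] Ox C2 phix phiu e0.
have := quadpoly_le phi x e e0 C2.
set l := \col_i _; set M := _ - _ => qphi.
have Msym : M^T = M.
  by rewrite [LHS]raddfB /= [(e *: _)^T]linearZ /= trmx1 hessian_sym.
(* [q] is the lowered Taylor polynomial of [phi] composed with [A], so it touches the composed
   function from below at [invmx A *m x]. *)
pose q := quadpoly (phi x) (A^T *m l) (A^T *m M *m A) (invmx A *m x).
have AMAsym : (A^T *m M *m A)^T = A^T *m M *m A.
  by rewrite !trmx_mul trmxK Msym mulmxA.
rewrite -(hessian_quadpoly (phi x) (A^T *m l) _ (invmx A *m x) (invmx A *m x) AMAsym).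
apply: test.
- by rewrite /= mulKVmx.
- exact: C2_quadpoly.
- by rewrite quadpoly_center mulKVmx.
- have H : \forall y \near A *m (invmx A *m x),
      ((quadpoly (phi x) l M x y)%:E <= u y)%E.
    rewrite mulKVmx//; near=> y; apply: le_trans (_ : (phi y)%:E <= _)%E.
      by rewrite lee_fin; near: y.
    by near: y.
  by have := near_mulmx _ _ _ H; apply: filterS => y; rewrite quadpoly_comp.
Unshelve. all: by end_near. Qed.

End linear_change.

(** * Testing [F] against the matrices of its convex body *)

Theorem theorem4p1p1 (R : realType) (n : nat) (n_ge2 : (2 <= n)%N)
    (F : 'M[R]_n -> R) (K : set 'M[R]_n)
    (F_sublin : sublinear F) (F_ell : uniformly_elliptic F)
    (FK : associated_body F K)
    (Omega : set 'cV[R]_n) (Omega_neq0 : Omega !=set0) (Omega_open : open Omega)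
    (u : 'cV[R]_n -> \bar R) (u_gtNy : forall x, Omega x -> (-oo < u x)%E) :
  visc_supersolution F Omega u <->
  forall Z : 'M[R]_n, K Z ->
    superharmonic [set x | Omega (sqrtmx Z *m x)] (fun x => u (sqrtmx Z *m x)).
Proof.
have KP Z : K Z -> [/\ (sqrtmx Z)^T = sqrtmx Z, sqrtmx Z \in unitmx &
    sqrtmx Z *m sqrtmx Z = Z].
  move=> /(body_posdefmx F_sublin F_ell FK)/sqrtmxP[Spos SS]; split => //.
    by apply/symmxP; case: Spos.
  exact: posdefmx_unit.
have [_ [Z0 KZ0] _ _ Fmax] := FK.
split=> [viscF Z KZ|harm].
  have [Ssym Su SS] := KP Z KZ; set S := sqrtmx Z in Ssym Su SS *.
  have invK (x : 'cV[R]_n) : S *m (invmx S *m x) = x by rewrite mulKVmx.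
  have [_ lsc dense test] := viscF; split.
  - by move=> x; exact: u_gtNy.
  - exact: lower_semicontinuous_mulmx.
  - exact: closure_mulmx dense.
  move=> x phi Ox C2 phix phiu.
  (* [u] is regarded as [u_Z] composed with [invmx S], so that test functions of [u_Z] can be
     transferred to [u]. *)
  have visc' : visc_supersolution F
      [set y | [set z | Omega (S *m z)] (invmx S *m y)]
      (fun y => (fun z => u (S *m z)) (invmx S *m y)).
    have -> : [set y | [set z | Omega (S *m z)] (invmx S *m y)] = Omega.
      by apply/seteqP; split=> y /=; rewrite invK.
    by under eq_fun do rewrite invK.
  apply/ler_addgt0Pl => e e0; rewrite addr0.
  (* Lowering the Hessian by [d *: 1%:M] costs [d * n <= e] in the trace. *)
  pose d := e / (n%:R + 1); have d0 : 0 < d by rewrite divr_gt0// ltr_wpDl.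
  have iSu : invmx S \in unitmx by rewrite unitmx_inv.
  have := visc_supersolution_quadpoly F [set z | Omega (S *m z)]
    (fun z => u (S *m z)) _ x phi d iSu visc' Ox C2 phix phiu d0.
  rewrite trmx_inv Ssym; set M := _ - _ => FM.
  have Msym : invmx S *m M *m invmx S \is symmetricmx.
    apply/symmxP; rewrite !trmx_mul trmx_inv Ssym mulmxA; congr (_ *m _ *m _).
    rewrite /M [LHS]raddfB /= [(d *: _)^T]linearZ /= trmx1.
    by rewrite hessian_sym.
  (* Pairing [Z = S *m S] with [invmx S *m M *m invmx S] gives [\tr M], which is therefore at most a
     nonpositive value of [F]. *)
  have [_ /(_ _ KZ)] := Fmax _ Msym.
  rewrite /frobenius -SS !mulmxA mulmxK// mxtrace_mulC !mulmxA mulVmx// mul1mx.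
  rewrite /M raddfB /= mxtraceZ mxtrace1 => trM.
  have : d * n%:R <= e by rewrite /d mulrAC ler_pdivrMr ?ltr_wpDl// ler_pM2l// lerDl.
  by have := le_trans trM FM; lra.
split=> //.
(* Semicontinuity and density do not depend on the operator, so a single [Z0] in the nonempty [K]
   suffices to recover them for [u]. *)
- have [Ssym Su SS] := KP Z0 KZ0; set S := sqrtmx Z0 in Ssym Su SS.
  have invK (x : 'cV[R]_n) : S *m (invmx S *m x) = x by rewrite mulKVmx.
  have [_ lsc _ _] := harm _ KZ0.
  have := lower_semicontinuous_mulmx _ _ (invmx S) lsc; rewrite -/S.
  have -> : [set y | [set z | Omega (S *m z)] (invmx S *m y)] = Omega.
    by apply/seteqP; split=> y /=; rewrite invK.
  by under eq_fun do rewrite invK.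
- have [Ssym Su SS] := KP Z0 KZ0; set S := sqrtmx Z0 in Ssym Su SS.
  have invK (x : 'cV[R]_n) : S *m (invmx S *m x) = x by rewrite mulKVmx.
  have iSu : invmx S \in unitmx by rewrite unitmx_inv.
  have [_ _ dense _] := harm _ KZ0.
  have := closure_mulmx _ _ _ iSu dense; rewrite -/S => H x Ox.
  have /H : [set y | [set z | Omega (S *m z)] (invmx S *m y)] x by rewrite /= invK.
  by apply: closure_subset => y /=; rewrite invK.
move=> x phi Ox C2 phix phiu.
have Hsym : hessian phi x \is symmetricmx by apply/symmxP; exact: hessian_sym.
(* The matrix [Z] attaining the maximum depends on the test Hessian, which is why every [Z] in [K]
   is tested. *)
have [[Z KZ ->] _] := Fmax _ Hsym.
have [Ssym Su SS] := KP Z KZ.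
apply/ler_addgt0Pl => e e0; rewrite addr0.
(* The lowering now costs [d * \tr Z <= e], as it is paired with [Z]. *)
pose d := e / (`|\tr Z| + 1); have d0 : 0 < d by rewrite divr_gt0// ltr_wpDl.
have := visc_supersolution_quadpoly _ Omega u _ x phi d Su (harm _ KZ) Ox C2 phix phiu d0.
rewrite Ssym mxtrace_mulC mulmxA SS mulmxBr raddfB /= -scalemxAr mulmx1 mxtraceZ.
have : d * \tr Z <= e.
  rewrite /d mulrAC ler_pdivrMr ?ltr_wpDl// ler_pM2l//.
  by rewrite (le_trans (ler_norm _))// lerDl.
by rewrite /frobenius; lra.
Qed.
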